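(* Let $(V,E)$ be a rooted directed tree with no leaves and let $\lambda=(\lambda_v)_{v\in V}$ be a weight, i.e. a family of non-zero scalars in $\mathbb{K}$. Let $B_\lambda$ be the associated weighted backward shift. (a) Let $X=\ell^1(V)$, and let $B_\lambda$ be bounded on $X$. Then $B_\lambda$ is chain recurrent if and only if for every $v\in V$, $\sum_{n=0}^\infty\sup_{u\in\mathrm{Chi}^n(v)}|\lambda(v\to u)|=\infty$. (b) Let $X=\ell^p(V)$, $1<p<\infty$, and let $B_\lambda$ be bounded on $X$. Then $B_\lambda$ is chain recurrent if and only if for every $v\in V$, $\sum_{n=0}^\infty \big( \sum_{u\in \mathrm{Chi}^n(v)} |\lambda(v\to u)|^{p^*}\big)^{1/p^*}=\infty$. (c) Let $X=c_0(V)$, and let $B_\lambda$ be bounded on $X$. Then $B_\lambda$ is chain recurrent if and only if for every $v\in V$, $\sum_{n=0}^\infty \sum_{u\in \mathrm{Chi}^n(v)} |\lambda(v\to u)|=\infty$.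
   Context: Directed trees. A directed tree $(V,E)$ is a connected directed graph with countable vertex set $V$ and edge set $E\subset V\times V\setminus\{(v,v):v\in V\}$ such that: it has no cycles; each vertex $v$ has at most one parent, i.e. a unique vertex $\mathrm{par}(v)$ with $(\mathrm{par}(v),v)\in E$; and there is at most one vertex with no parent, called the root if it exists. The tree is rooted if it has a root. $\mathrm{par}^n$ is the $n$-fold iterate of $\mathrm{par}$ (where defined), with $\mathrm{par}^0(v)=v$. A child of $v$ is a vertex whose parent is $v$; $\mathrm{Chi}(v)$ is the set of children of $v$; $\mathrm{Chi}^0(v)=\{v\}$ and, for $n\ge1$, $\mathrm{Chi}^n(v)$ is the union of the sets $\mathrm{Chi}(w)$ over $w\in\mathrm{Chi}^{n-1}(v)$. A leaf is a vertex with no children. Spaces. $\mathbb{K}$ is $\mathbb{R}$ or $\mathbb{C}$. For $1\le p<\infty$, $\ell^p(V)=\{f\in\mathbb{K}^V:\sum_{v\in V}|f(v)|^p<\infty\}$ with norm $\|f\|_p=(\sum_{v}|f(v)|^p)^{1/p}$; $c_0(V)$ is the space of $f\in\mathbb{K}^V$ such that for every $\varepsilon>0$ there is a finite $F\subset V$ with $|f(v)|<\varepsilon$ for all $v\in V\setminus F$, with the supremum norm. For $1<p<\infty$, $p^*$ is the number with $1/p+1/p^*=1$. Shifts. For a weight $\lambda$, the weighted backward shift is $[B_\lambda(f)](v)=\sum_{u\in\mathrm{Chi}(v)}\lambda_u f(u)$ for $v\in V$. ''$B_\lambda$ is bounded on $X$'' means it is a well-defined continuous linear operator $X\to X$. For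 $n\ge1$ and $u\in\mathrm{Chi}^n(v)$, $\lambda(v\to u)=\lambda_{\mathrm{par}^{n-1}(u)}\cdots\lambda_{\mathrm{par}(u)}\lambda_u$ (so $\lambda_v$ is not included), and $\lambda(v\to v)=1$. Chain recurrence. For a map $f:X\to X$ on a metric space $(X,d)$ and $\delta>0$, a $\delta$-chain from $x$ to $y$ is a finite sequence $(x_j)_{j=0}^k$, $k\ge1$, with $x_0=x$, $x_k=y$ and $d(f(x_j),x_{j+1})\le\delta$ for $0\le j<k$. The map $f$ is chain recurrent if for every $x\in X$ and every $\delta>0$ there is a $\delta$-chain for $f$ from $x$ to itself. *)

(* Defs.v *)
From HB Require Import structures.
From mathcomp Require Import all_boot all_order all_algebra.
From mathcomp Require Import complex.
From mathcomp Require Import all_classical all_reals all_analysis.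
From mathcomp.analysis.showcase Require summability.

Set Implicit Arguments.
Unset Strict Implicit.
Unset Printing Implicit Defensive.

Import Order.TTheory GRing.Theory Num.Theory.
Import numFieldNormedType.Exports.

Local Open Scope classical_set_scope.
Local Open Scope ring_scope.

Section DirectedTrees.
Variables (V : countType) (E : rel V).

(* [cycle E c] relates consecutive entries of [c] and its last entry to the
   first; together with the at-most-one-parent condition, excluding directed
   cycles also excludes undirected ones. *)
Record directed_tree : Prop := DirectedTree {
  dtree_noloop : forall v, ~~ E v v;
  dtree_connected : forall u v,
    exists s, path (fun x y => E x y || E y x) u s /\ last u s = v;
  dtree_acyclic : forall c, c != [::] -> ~ ucycle E c;
  dtree_parent : forall u w v, E u v -> E w v -> u = w;
  dtree_root : forall v w,
    (forall u, ~~ E u v) -> (forall u, ~~ E u w) -> v = w }.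

Definition rooted : Prop := exists v, forall u, ~~ E u v.

Definition children (v : V) : set V := [set u | E v u].

Definition leafless : Prop := forall v, children v !=set0.

Fixpoint descendants (n : nat) (v : V) : set V :=
  if n is n'.+1 then \bigcup_(w in descendants n' v) children w else [set v].

(* Junk value: the root is its own [parent]. *)
Definition parent (v : V) : V := xget v [set u | E u v].

End DirectedTrees.

Variant scalars := RealScalars | ComplexScalars.

Definition scalar_field (R : realType) (s : scalars) : numFieldType :=
  match s with RealScalars => R | ComplexScalars => R[i] end.

Definition modulus (R : realType) (s : scalars) : scalar_field R s -> R :=
  match s with
  | RealScalars => fun x => `|x|
  | ComplexScalars => fun z => Normc.normc z
  end.

Section Spaces.
Variables (R : realType) (s : scalars) (V : countType).
Local Notation K := (scalar_field R s).

Record fun_space := FunSpace {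
  fs_carrier : set (V -> K);
  fs_norm : (V -> K) -> R }.

Definition fs_dist (X : fun_space) (f g : V -> K) : R := fs_norm X (f \- g).

Definition lp (p : R) : fun_space := FunSpace
  [set f | (\esum_(v in [set: V]) (modulus (f v) `^ p)%:E < +oo)%E]
  (fun f => fine (\esum_(v in [set: V]) (modulus (f v) `^ p)%:E) `^ p^-1).

Definition c0 : fun_space := FunSpace
  [set f | forall e : R, 0 < e ->
     exists2 F : set V, finite_set F & forall v, ~ F v -> modulus (f v) < e]
  (fun f => sup (range (fun v => modulus (f v)))).

End Spaces.

Section Shifts.
Variables (R : realType) (s : scalars) (V : countType) (E : rel V).
Local Notation K := (scalar_field R s).
Variable lam : V -> K.

(* The children of a vertex carry no order: the sum over them is the limit of
   the finite partial sums along the directed set of finite subsets of [V]. *)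
Definition bshift_term (f : V -> K) (v u : V) : K :=
  if E v u then lam u * f u else 0.

Definition bshift_defined (f : V -> K) : Prop := forall v,
  cvg (summability.partial_sum (bshift_term f v) @ summability.totally).

Definition bshift (f : V -> K) : V -> K := fun v =>
  lim (summability.partial_sum (bshift_term f v) @ summability.totally).

Definition bshift_bounded (X : fun_space R s V) : Prop :=
  [/\ forall f, fs_carrier X f -> bshift_defined f /\ fs_carrier X (bshift f),
      forall (a : K) (f g : V -> K), fs_carrier X f -> fs_carrier X g ->
        bshift (fun v => a * f v + g v) = (fun v => a * bshift f v + bshift g v)
    & forall f, fs_carrier X f -> forall e : R, 0 < e -> exists2 d : R, 0 < d &
        forall g, fs_carrier X g -> fs_dist X f g < d ->
          fs_dist X (bshift f) (bshift g) < e].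

(* $\lambda(v \to u)$ for $u \in \mathrm{Chi}^n(v)$; the vertex $v$, which is
   the [n]-th iterated parent of [u], is determined by [n] and [u]. *)
Definition path_weight (n : nat) (u : V) : K :=
  \prod_(k < n) lam (iter k (parent E) u).

End Shifts.

Section ChainRecurrence.
Variables (R : realType) (T : Type) (X : set T) (d : T -> T -> R) (f : T -> T).

Definition delta_chain (delta : R) (x y : T) : Prop :=
  exists k (z : nat -> T),
    [/\ (1 <= k)%N, forall j, (j <= k)%N -> X (z j), z 0 = x, z k = y
      & forall j, (j < k)%N -> d (f (z j)) (z j.+1) <= delta].

Definition chain_recurrent : Prop :=
  forall x, X x -> forall delta : R, 0 < delta -> delta_chain delta x x.

End ChainRecurrence.

(* Main.v *)
(* Write [a n v] for the norm, in the dual of [X], of the functional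
   [f |-> (B^n f)(v)], whose coefficients are the path weights over [Chi^n(v)];
   by Hoelder duality the three series of the theorem are all [sum_n a n v].
   Suppose it converges at [v]. As [v] is not its own descendant, in a
   delta-chain from the unit vector at [v] to itself the final value [1] at [v]
   comes from the errors alone, so [1 <= delta * sum_n a n v], which fails for
   small delta. Conversely, finitely supported vectors are annihilated by some
   power of [B] since the tree has a root, and by density every vector chains to
   [0]; if the series diverges at [v], pushing errors of size delta supported on
   [Chi^n(v)], [n < N], through [B^n] builds any multiple of the unit vector at
   [v] from [0]. Chains of equal length starting at [0] add up, so [0] chains to
   every finitely supported vector, hence to every vector. *)
Require Import Defs.
From mathcomp Require Import all_boot all_order all_algebra.
From mathcomp Require Import finmap ring lra complex.
From mathcomp Require Import all_classical all_reals all_analysis.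
From mathcomp.analysis.showcase Require summability.

Set Implicit Arguments.
Unset Strict Implicit.
Unset Printing Implicit Defensive.

Import Order.TTheory GRing.Theory Num.Theory.
Import numFieldNormedType.Exports.

Local Open Scope classical_set_scope.
Local Open Scope ring_scope.

(** * Unordered sums of reals, reduced to finite sums over duplicate-free sequences *)

Section ExtendedSums.
Variables (R : realType) (T : choiceType).
Implicit Types (A : set T) (f g : T -> R) (s : seq T).

Lemma ge_esum_seq A (a : T -> \bar R) (c : \bar R) :
  (forall s, uniq s -> (forall u, u \in s -> A u) ->
     (\sum_(u <- s) a u <= c)%E) ->
  (\esum_(u in A) a u <= c)%E.
Proof.
move=> sc; apply: ge_ereal_sup => _ [X [finX XA]] <-.
rewrite fsbig_finite//; apply: sc => // u.
by rewrite in_fset_set// inE => /XA.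
Qed.

Lemma esum_ge_seq A (a : T -> \bar R) s : uniq s ->
  (forall u, u \in s -> A u) ->
  (\sum_(u <- s) a u <= \esum_(u in A) a u)%E.
Proof.
move=> us sA; apply: esum_ge; exists [set` s] => //.
by rewrite -fsbig_seq.
Qed.

Lemma esum_leP A f (c : R) :
  (\esum_(u in A) (f u)%:E <= c%:E)%E <->
  (forall s, uniq s -> (forall u, u \in s -> A u) -> \sum_(u <- s) f u <= c).
Proof.
split=> [h s us sA|h].
  by rewrite -lee_fin -sumEFin (le_trans _ h)//; exact: esum_ge_seq.
by apply: ge_esum_seq => s us sA; rewrite sumEFin lee_fin; exact: h.
Qed.

Lemma esum_gt_seq A f (c : R) : (c%:E < \esum_(u in A) (f u)%:E)%E ->
  exists s, [/\ uniq s, (forall u, u \in s -> A u) & c < \sum_(u <- s) f u].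
Proof.
move=> h; apply: contrapT => hs; move: h; apply/negP; rewrite -leNgt.
apply/esum_leP => s us sA; rewrite leNgt; apply/negP => cs.
by apply: hs; exists s.
Qed.

Lemma esum_fin A f : (forall u, A u -> 0 <= f u) ->
  (\esum_(u in A) (f u)%:E < +oo)%E ->
  exists2 c : R, 0 <= c & (\esum_(u in A) (f u)%:E = c%:E)%E.
Proof.
move=> f0 foo; have h0 : (0 <= \esum_(u in A) (f u)%:E)%E.
  by apply: esum_ge0 => u /f0; rewrite lee_fin.
exists (fine (\esum_(u in A) (f u)%:E)); first exact: fine_ge0.
by rewrite fineK// ge0_fin_numE.
Qed.

(** One inequality suffices: applied to the factor [c] it gives one direction, applied to [c^-1] and
    the family [c * f] it gives the other. *)
Lemma esumZl A f (c : R) : 0 <= c -> (forall u, A u -> 0 <= f u) ->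
  (\esum_(u in A) (c * f u)%:E = c%:E * \esum_(u in A) (f u)%:E)%E.
Proof.
move=> c0 f0.
have le_esumZ (b : R) (h : T -> R) : 0 <= b -> (forall u, A u -> 0 <= h u) ->
    (\esum_(u in A) (b * h u)%:E <= b%:E * \esum_(u in A) (h u)%:E)%E.
  move=> b0 h0; apply: ge_esum_seq => s us sA.
  rewrite sumEFin -mulr_sumr EFinM -sumEFin lee_pmul//.
    by rewrite sumEFin lee_fin big_seq sumr_ge0// => u /sA; exact: h0.
  exact: esum_ge_seq.
apply/eqP; rewrite eq_le le_esumZ//=.
have [<-|cp] := eqVneq 0 c.
  by rewrite mul0e; apply: esum_ge0 => u _; rewrite mul0r.
have {}cp : 0 < c by rewrite lt_def eq_sym cp.
rewrite -lee_pdivlMl//; under eq_esum do rewrite -[f _](mulKf (lt0r_neq0 cp)).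
apply: le_esumZ; first by rewrite invr_ge0.
by move=> u Au; rewrite mulr_ge0// f0.
Qed.

End ExtendedSums.

(** * Hoelder and Minkowski inequalities for finite sums *)

Section FiniteSums.
Variables (R : realType) (T : eqType).
Implicit Types (s : seq T) (f g : T -> R) (p q a b : R).

Lemma powRK q a : 0 <= a -> q != 0 -> (a `^ q) `^ q^-1 = a.
Proof. by move=> a0 q0; rewrite -powRrM divff// powRr1. Qed.

Lemma powRVK q a : 0 <= a -> q != 0 -> (a `^ q^-1) `^ q = a.
Proof. by move=> a0 q0; rewrite -powRrM mulVf// powRr1. Qed.

Lemma ler_powR_pos q x y : 0 < q -> 0 <= x -> 0 <= y ->
  (x `^ q <= y `^ q) = (x <= y).
Proof.
move=> q0 x0 y0; apply/idP/idP => [xy|]; last first.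
  by apply: ge0_ler_powR; rewrite ?nnegrE// ltW.
rewrite -(powRK x0 (lt0r_neq0 q0)) -(powRK y0 (lt0r_neq0 q0)).
by apply: ge0_ler_powR; rewrite ?nnegrE ?powR_ge0// invr_ge0 ltW.
Qed.

Lemma sum_le_support s (t : seq T) (F : T -> R) :
  uniq s -> uniq t -> (forall u, 0 <= F u) ->
  (forall u, u \notin t -> F u = 0) ->
  \sum_(u <- s) F u <= \sum_(u <- t) F u.
Proof.
move=> us ut F0 Ft; rewrite (bigID (mem t))/= [X in _ + X]big1 ?addr0//.
rewrite [leRHS](bigID (mem s))/= -[leLHS]addr0 lerD ?sumr_ge0//.
rewrite -big_filter -[leRHS]big_filter (perm_big [seq u <- t | u \in s])//.
by apply: uniq_perm; rewrite ?filter_uniq// => u; rewrite !mem_filter andbC.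
Qed.

Lemma powR_sum_eq0 s f p : (forall u, 0 <= f u) -> 0 < p ->
  \sum_(u <- s) f u `^ p <= 0 -> forall u, u \in s -> f u = 0.
Proof.
move=> f0 p0 sle0 u us; apply/eqP.
have : \sum_(u <- s) f u `^ p == 0.
  by rewrite eq_le sle0 sumr_ge0// => v _; exact: powR_ge0.
rewrite psumr_eq0; last by move=> v _; exact: powR_ge0.
by move=> /allP/(_ _ us); rewrite /= powR_eq0 => /andP[].
Qed.

Lemma powR_divl p x a : 0 <= x -> 0 < a -> (x / a) `^ p = (a `^ p)^-1 * x `^ p.
Proof.
move=> x0 a0; rewrite powRM// ?invr_ge0 ?(ltW a0)// mulrC; congr (_ * _).
by rewrite -powR_inv1 ?(ltW a0)// powRAC powR_inv1// powR_ge0.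
Qed.

(** After division by [a] and [b], Young's inequality holds termwise and the two sums contribute at
    most [p^-1] and [q^-1]. Arbitrary bounds [a], [b] replace the norms, so that norms of infinite
    families can be inserted; a zero bound forces all terms to vanish and is treated apart. *)
Lemma hoelder_sum s f g p q a b :
  (forall u, 0 <= f u) -> (forall u, 0 <= g u) -> 0 <= a -> 0 <= b ->
  0 < p -> 0 < q -> p^-1 + q^-1 = 1 ->
  \sum_(u <- s) f u `^ p <= a `^ p -> \sum_(u <- s) g u `^ q <= b `^ q ->
  \sum_(u <- s) f u * g u <= a * b.
Proof.
move=> f0 g0 a0 b0 p0 q0 pq fa gb.
have [az|az] := eqVneq a 0.
  rewrite az powR0 ?gt_eqF// in fa; rewrite az mul0r big1_seq// => u /andP[_ us].
  by rewrite (powR_sum_eq0 f0 p0 fa us) mul0r.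
have [bz|bz] := eqVneq b 0.
  rewrite bz powR0 ?gt_eqF// in gb; rewrite bz mulr0 big1_seq// => u /andP[_ us].
  by rewrite (powR_sum_eq0 g0 q0 gb us) mulr0.
have {}a0 : 0 < a by rewrite lt_def az. have {}b0 : 0 < b by rewrite lt_def bz.
have ab0 : 0 < a * b by rewrite mulr_gt0.
rewrite -[leRHS]mulr1 -ler_pdivrMl// mulr_sumr.
have young u : (a * b)^-1 * (f u * g u) <=
    p^-1 * ((a `^ p)^-1 * f u `^ p) + q^-1 * ((b `^ q)^-1 * g u `^ q).
  have -> : (a * b)^-1 * (f u * g u) = (f u / a) * (g u / b).
    by field; rewrite az bz.
  rewrite -!powR_divl// ![_^-1 * _ `^ _]mulrC.
  by apply: conjugate_powR; rewrite ?divr_ge0// ltW.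
apply: (le_trans (ler_sum _ (fun u _ => young u))).
rewrite big_split/= -!mulr_sumr -pq.
by apply: lerD; apply: ler_piMr; rewrite ?invr_ge0 ?(ltW p0) ?(ltW q0)//
  ler_pdivrMl ?powR_gt0// mulr1.
Qed.

Lemma convex_powR_comb p t x y : 1 <= p -> 0 <= t -> t <= 1 -> 0 <= x -> 0 <= y ->
  (t * x + (1 - t) * y) `^ p <= t * x `^ p + (1 - t) * y `^ p.
Proof.
move=> p1 t0 t1 x0 y0.
have := @convex_powR R p p1 (Itv01 t0 t1) x y.
by rewrite !convRE /= /unstable.onem; apply; rewrite inE/= in_itv/= andbT.
Qed.

(** Convexity of the [p]-th power, applied termwise to a convex combination of [f u / a] and
    [g u / b]. *)
Lemma minkowski_sum s f g p a b :
  (forall u, 0 <= f u) -> (forall u, 0 <= g u) -> 0 <= a -> 0 <= b -> 1 <= p ->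
  \sum_(u <- s) f u `^ p <= a `^ p -> \sum_(u <- s) g u `^ p <= b `^ p ->
  \sum_(u <- s) (f u + g u) `^ p <= (a + b) `^ p.
Proof.
move=> f0 g0 a0 b0 p1 fa gb.
have p0 : 0 < p by rewrite (lt_le_trans _ p1).
have [az|az] := eqVneq a 0.
  rewrite az powR0 ?gt_eqF// in fa; rewrite az add0r (le_trans _ gb)//.
  rewrite big_seq [leRHS]big_seq ler_sum// => u us.
  by rewrite (powR_sum_eq0 f0 p0 fa us) add0r.
have [bz|bz] := eqVneq b 0.
  rewrite bz powR0 ?gt_eqF// in gb; rewrite bz addr0 (le_trans _ fa)//.
  rewrite big_seq [leRHS]big_seq ler_sum// => u us.
  by rewrite (powR_sum_eq0 g0 p0 gb us) addr0.
have {}a0 : 0 < a by rewrite lt_def az. have {}b0 : 0 < b by rewrite lt_def bz.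
have ab0 : 0 < a + b by rewrite addr_gt0.
rewrite -[leRHS]mulr1 -ler_pdivrMl ?powR_gt0// mulr_sumr.
(* With this weight, [(f u + g u) / (a + b)] is exactly [t * (f u / a) + (1 - t) * (g u / b)]. *)
pose t := a / (a + b).
have t0 : 0 <= t by rewrite divr_ge0 // ltW.
have t1 : t <= 1 by rewrite ler_pdivrMr// mul1r lerDl ltW.
have conv u : ((a + b) `^ p)^-1 * (f u + g u) `^ p <=
    t * ((a `^ p)^-1 * f u `^ p) + (1 - t) * ((b `^ p)^-1 * g u `^ p).
  rewrite -!powR_divl ?addr_ge0//.
  have -> : (f u + g u) / (a + b) = t * (f u / a) + (1 - t) * (g u / b).
    by rewrite /t; field; rewrite az bz gt_eqF.
  by apply: convex_powR_comb => //; rewrite divr_ge0// ltW.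
apply: (le_trans (ler_sum _ (fun u _ => conv u))).
rewrite big_split/= -!mulr_sumr -[leRHS](subrKC t 1).
by apply: lerD; apply: ler_piMr; rewrite ?subr_ge0// ler_pdivrMl ?powR_gt0// mulr1.
Qed.

End FiniteSums.

(** * The modulus on the scalar field, treated uniformly in the real and complex cases *)

Section Scalars.
Variables (R : realType) (s : scalars).
Local Notation K := (scalar_field R s).
Implicit Types (x y z : K) (a b c : R).

(** The inclusion of the reals in [K]. The library norm takes values in [K] and [modulus] in [R];
    facts about the former pass to the latter through this order embedding. *)
Definition embed : R -> K :=
  match s return R -> scalar_field R s with
  | RealScalars => fun r : R => r
  | ComplexScalars => fun r : R => r%:C%C
  end.

Lemma embedM a b : embed (a * b) = embed a * embed b.
Proof. by rewrite /embed; case: s => //; exact: rmorphM. Qed.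

Lemma embedD a b : embed (a + b) = embed a + embed b.
Proof. by rewrite /embed; case: s => //; exact: rmorphD. Qed.

Lemma embed0 : embed 0 = 0.
Proof. by rewrite /embed; case: s. Qed.

Lemma embed1 : embed 1 = 1.
Proof. by rewrite /embed; case: s. Qed.

Lemma ler_embed a b : (embed a <= embed b) = (a <= b).
Proof. by rewrite /embed; case: s => //; rewrite lecR. Qed.

Lemma ltr_embed a b : (embed a < embed b) = (a < b).
Proof. by rewrite /embed; case: s => //; rewrite ltcR. Qed.

Lemma norm_modulus x : `|x| = embed (modulus x).
Proof. by move: x; rewrite /embed /modulus; case: s => //= -[]. Qed.

Lemma embed_inj : injective embed.
Proof. by rewrite /embed; case: s => //= a b []. Qed.

Lemma modulus_ge0 x : 0 <= modulus x.
Proof. by rewrite -ler_embed -norm_modulus embed0. Qed.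

Lemma modulus_embed a : 0 <= a -> modulus (embed a) = a.
Proof.
by move=> a0; apply: embed_inj; rewrite -norm_modulus ger0_norm// -embed0 ler_embed.
Qed.

Lemma modulusM x y : modulus (x * y) = modulus x * modulus y.
Proof. by apply: embed_inj; rewrite embedM -!norm_modulus normrM. Qed.

Lemma modulusN x : modulus (- x) = modulus x.
Proof. by apply: embed_inj; rewrite -!norm_modulus normrN. Qed.

Lemma ler_modulusD x y : modulus (x + y) <= modulus x + modulus y.
Proof. by rewrite -ler_embed embedD -!norm_modulus ler_normD. Qed.

Lemma modulus0 : modulus (0 : K) = 0.
Proof. by apply: embed_inj; rewrite -norm_modulus normr0 embed0. Qed.

Lemma modulus1 : modulus (1 : K) = 1.
Proof. by apply: embed_inj; rewrite -norm_modulus normr1 embed1. Qed.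

Lemma modulus_eq0 x : (modulus x == 0) = (x == 0).
Proof. by rewrite -(inj_eq embed_inj) embed0 -norm_modulus normr_eq0. Qed.

Lemma modulusV x : modulus x^-1 = (modulus x)^-1.
Proof.
have [->|x0] := eqVneq x 0; first by rewrite invr0 modulus0 invr0.
have mx0 : modulus x != 0 by rewrite modulus_eq0.
by apply: (mulfI mx0); rewrite -modulusM !divff// modulus1.
Qed.

Lemma ler_modulus_sum (I : Type) (r : seq I) (F : I -> K) :
  modulus (\sum_(i <- r) F i) <= \sum_(i <- r) modulus (F i).
Proof.
elim: r => [|i r IH]; first by rewrite !big_nil modulus0.
by rewrite !big_cons (le_trans (ler_modulusD _ _))// lerD2l.
Qed.

(* For [x != 0] this is the unimodular scalar rotating [x] onto its modulus. *)
Definition phase x : K := embed (modulus x) / x.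

Lemma modulus_phase x : x != 0 -> modulus (phase x) = 1.
Proof.
by move=> x0; rewrite /phase modulusM modulusV modulus_embed ?modulus_ge0//
  divff// modulus_eq0.
Qed.

Lemma phaseK x : x != 0 -> x * phase x = embed (modulus x).
Proof. by move=> x0; rewrite /phase mulrCA divff// mulr1. Qed.

End Scalars.

(** * Limits of partial sums along finite subsets *)

Section UnorderedSums.
Variables (R : realType) (s : scalars) (V : countType).
Local Notation K := (scalar_field R s).
Implicit Types (F : V -> K).

Lemma partial_sum_seq F (A : {fset V}) :
  summability.partial_sum F A = \sum_(u <- A) F u.
Proof. by rewrite (big_seq_fsetE _ _ xpredT). Qed.

Lemma modulus_lim_le F (c : R) :
  cvg (summability.partial_sum F @ summability.totally) ->
  (forall t : seq V, uniq t -> \sum_(u <- t) modulus (F u) <= c) ->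
  modulus (lim (summability.partial_sum F @ summability.totally) : K) <= c.
Proof.
move=> cF Fc; set l := lim _; rewrite leNgt; apply/negP => cl.
(* The excess of [modulus l] over [c] is taken as radius: a finite partial sum closer to [l] than
   this would have modulus above [c]. *)
have e0 : 0 < embed s (modulus l - c) by rewrite -embed0 ltr_embed subr_gt0.
have := cF _ (nbhsx_ballx l _ e0).
rewrite /= => -[A _ /(_ A)]; rewrite /= fsubset_refl => /(_ isT).
rewrite partial_sum_seq /ball/= norm_modulus ltr_embed ltNge => /negP; apply.
have := Fc A (fset_uniq A); have := ler_modulus_sum A F.
set t := \sum_(u <- A) F u => h1 h2.
have := ler_modulusD (l - t) t; rewrite subrK; lra.
Qed.

(** The partial sums are constant on all finite sets containing [u]. *)
Lemma lim_partial_sum_single F (u : V) : (forall v, v != u -> F v = 0) ->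
  lim (summability.partial_sum F @ summability.totally) = F u.
Proof.
move=> F0; apply: cvg_lim => //; first exact: summability.totally_filter.
move=> B /nbhs_singleton Bl; exists (fset1 u) => // A /=.
rewrite fsub1set => uA; rewrite partial_sum_seq.
rewrite (bigD1_seq u) ?fset_uniq//= big1 ?addr0// => v; exact: F0.
Qed.

End UnorderedSums.

(** * Depth and descendants in a rooted tree *)

Section Trees.
Variables (V : countType) (E : rel V).
Hypothesis tree : directed_tree E.

Lemma parentE u v : E u v -> parent E v = u.
Proof.
move=> Euv; rewrite /parent; case: xgetP => [w _ /= Ewv|/(_ u)//].
exact: dtree_parent tree _ _ _ Ewv Euv.
Qed.

Lemma iter_parent_descendants n v u :
  descendants E n v u -> iter n (parent E) u = v.
Proof.
by elim: n u => [|n IH] u //= [w /IH <- /parentE <-]; rewrite -iterSr.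
Qed.

Lemma descendants_neq0 n v : leafless E -> descendants E n v !=set0.
Proof.
move=> leafl; elim: n => [|n [w nw]]; first by exists v.
by have [u wu] := leafl w; exists u; exists w.
Qed.

Variable r : V.
Hypothesis rootr : forall u, ~~ E u r.

Lemma parent_root : parent E r = r.
Proof.
rewrite /parent; case: xgetP => // w _ /= Ewr.
by have := rootr w; rewrite Ewr.
Qed.

(** Induction along an undirected path from the root: an edge traversed downwards increases the
    number of parent steps by one, an edge traversed upwards decreases it. *)
Lemma depth_exists v : exists n, iter n (parent E) v = r.
Proof.
have [t [+ <-]] := dtree_connected tree r v.
elim/last_ind: t => [|t x IH]; first by exists 0.
rewrite rcons_path last_rcons => /andP[/IH [n nr] /orP[/parentE px|/parentE px]].
  by exists n.+1; rewrite iterSr px.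
case: n nr => [|n] nr; last by exists n; rewrite -nr iterSr px.
(* The path stands at the root, and the junk value [parent E r = r] gives [x = r]. *)
by exists 0; rewrite -nr /= -px; rewrite -[last r t]/(iter 0 (parent E) _) nr parent_root.
Qed.

Lemma iter_parent_root n : iter n (parent E) r = r.
Proof. by elim: n => //= n ->; rewrite parent_root. Qed.

(** Otherwise [v] is fixed by [n.+1] parent steps and hence by every multiple of them. Sufficiently
    many steps end at the root, so [v] is the root, yet [v] has a parent. *)
Lemma descendants_irrefl n v : ~ descendants E n.+1 v v.
Proof.
move=> vv; have [m mr] := depth_exists v.
have itv := iter_parent_descendants vv.
have itvk k : iter (k * n.+1) (parent E) v = v.
  by elim: k => // k IH; rewrite mulSn iterD IH.
have vr : v = r.
  by rewrite -(itvk m) mulnS addnC iterD mr iter_parent_root.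
by case: vv => w _ /= Ewv; have := rootr w; rewrite -{1}vr Ewv.
Qed.

End Trees.

(** * Iterates of the shift and path weights *)

Section ShiftOnTree.
Variables (R : realType) (s : scalars) (V : countType) (E : rel V).
Local Notation K := (scalar_field R s).
Variables (lam : V -> K).
Local Notation B := (bshift E lam).
Local Notation pw := (path_weight E lam).
Implicit Types (f g : V -> K) (u v w : V).
Hypothesis tree : directed_tree E.

Lemma path_weightS n u : pw n.+1 u = lam u * pw n (parent E u).
Proof.
rewrite /path_weight big_ord_recl; congr (_ * _).
by apply: eq_bigr => i _; rewrite -iterSr.
Qed.

Lemma path_weight_neq0 n u : (forall v, lam v != 0) -> pw n u != 0.
Proof. by move=> lam0; apply/prodf_neq0. Qed.

Definition delta u : V -> K := fun v => (v == u)%:R.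

Lemma bshift_delta u v : B (delta u) v = if E v u then lam u else 0.
Proof.
rewrite /bshift (@lim_partial_sum_single _ _ _ _ u) => [|w wu].
  by rewrite /bshift_term /delta eqxx mulr1.
by rewrite /bshift_term /delta (negbTE wu) mulr0 if_same.
Qed.

Lemma bshift_delta_root r : (forall u, ~~ E u r) -> B (delta r) = fun=> 0.
Proof.
by move=> rootr; apply/funext => v; rewrite bshift_delta (negbTE (rootr v)).
Qed.

Lemma bshift_delta_child v u : E v u ->
  B (delta u) = fun w => lam u * delta v w.
Proof.
move=> vu; apply/funext => w; rewrite bshift_delta /delta.
have [->|wv] := eqVneq w v; first by rewrite vu mulr1.
case: ifPn => [wu|_]; last by rewrite mulr0.
by rewrite (dtree_parent tree wu vu) eqxx in wv.
Qed.

Lemma bshift_le f v : bshift_defined E lam f ->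
  ((modulus (B f v))%:E <=
   \esum_(u in children E v) (modulus (lam u) * modulus (f u))%:E)%E.
Proof.
move=> /(_ v) df; set S := esum _ _.
have [Soo|Sfin] := ltP S +oo%E; last by rewrite (le_trans (leey _)).
have [|c c0 Sc] := esum_fin _ Soo.
  by move=> u _; rewrite mulr_ge0// modulus_ge0.
rewrite /S Sc lee_fin; apply: modulus_lim_le df _ => t ut.
have /esum_leP/(_ [seq u <- t | E v u]) : (S <= c%:E)%E by rewrite /S Sc.
move=> /(_ (filter_uniq _ ut)) cs; apply: le_trans (cs _); last first.
  by move=> u; rewrite mem_filter => /andP[].
rewrite big_filter big_mkcond [leRHS]big_mkcond/=; apply: ler_sum => u _.
by rewrite /bshift_term; case: ifPn => _; rewrite ?modulusM ?modulus0.
Qed.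

(** Distinct vertices have disjoint sets of children, so the second projection is a bijection from
    the pairs (vertex of [A], child) onto the union. *)
Lemma esum_bigcup_children (A : set V) (a : V -> \bar R) :
  (forall u, 0 <= a u)%E ->
  (\esum_(u in \bigcup_(w in A) children E w) a u =
   \esum_(w in A) \esum_(u in children E w) a u)%E.
Proof.
move=> a0; rewrite esum_esum; last by move=> *; exact: a0.
apply: (@reindex_esum _ _ _ _ _ snd); split.
- by move=> [w u] [/= Aw wu]; exists w.
- move=> [w u] [w' u']; rewrite !inE => -[/= _ wu] [/= _ wu'] uu'.
  by rewrite -uu' in wu' *; rewrite (dtree_parent tree wu wu').
- by move=> u [w Aw wu]; exists (w, u).
Qed.

Variable X : fun_space R s V.
Hypothesis Xbounded : bshift_bounded E lam X.

Lemma iter_bshift_closed n f : fs_carrier X f -> fs_carrier X (iter n B f).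
Proof.
by have [XB _ _] := Xbounded; elim: n => //= n IH /IH/XB[].
Qed.

(** [iter n B f v] is an [n]-fold nested limit; iterating the one-step bound on moduli avoids
    interchanging these limits, and this inequality is all that the duality estimate requires. *)
Lemma iter_bshift_le n f v : fs_carrier X f ->
  ((modulus (iter n B f v))%:E <=
   \esum_(u in descendants E n v) (modulus (pw n u) * modulus (f u))%:E)%E.
Proof.
have [XB _ _] := Xbounded.
elim: n f => [|n IH] f Xf /=.
  by rewrite esum_set1 ?lee_fin ?mulr_ge0 ?modulus_ge0// /path_weight big_ord0
    modulus1 mul1r.
have [df XBf] := XB _ Xf.
rewrite esum_bigcup_children; last by move=> u; rewrite lee_fin mulr_ge0// modulus_ge0.
rewrite -iterS iterSr (le_trans (IH _ XBf))//; apply: le_esum => w _.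
rewrite EFinM (le_trans (lee_wpmul2l _ (bshift_le _ df)))//.
  by rewrite lee_fin modulus_ge0.
rewrite -esumZl ?modulus_ge0//; last by move=> u _; rewrite mulr_ge0// modulus_ge0.
apply: le_esum => u wu.
by rewrite path_weightS (parentE tree wu) modulusM lee_fin mulrA
  [modulus (pw n w) * _]mulrC.
Qed.

Lemma iter_bshift_comb n (a : K) f g : fs_carrier X f -> fs_carrier X g ->
  iter n B (fun v => a * f v + g v) =
  fun v => a * iter n B f v + iter n B g v.
Proof.
have [_ Blin _] := Xbounded.
move=> Xf Xg; elim: n => //= n ->.
by rewrite Blin//; exact: iter_bshift_closed.
Qed.

Hypothesis X0 : fs_carrier X (fun=> 0).

Lemma iter_bshift0 n : iter n B (fun=> 0) = fun=> 0.
Proof.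
(* Linearity is available only for combinations [a * f + g]; the coefficient [-1] with [f = g = 0]
   writes the image of [0] as a difference of equal vectors. *)
have := iter_bshift_comb n (-1) X0 X0.
rewrite (_ : (fun v : V => -1 * 0 + 0) = fun=> 0); last first.
  by apply/funext => v; rewrite mulr0 addr0.
by move=> ->; apply/funext => v; rewrite mulN1r addNr.
Qed.

Lemma iter_bshiftZ n (a : K) f : fs_carrier X f ->
  iter n B (fun v => a * f v) = fun v => a * iter n B f v.
Proof.
move=> Xf; have := iter_bshift_comb n a Xf X0; rewrite iter_bshift0.
have -> : (fun v => a * f v + 0) = (fun v => a * f v).
  by apply/funext => v; rewrite addr0.
by move=> ->; apply/funext => v; rewrite addr0.
Qed.

Hypothesis Xdelta : forall u, fs_carrier X (delta u).

Lemma iter_bshift_delta n v u : descendants E n v u ->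
  iter n B (delta u) = fun w => pw n u * delta v w.
Proof.
elim: n u => [|n IH] u /=.
  by move=> ->; apply/funext => w; rewrite /path_weight big_ord0 mul1r.
move=> [w nw wu]; rewrite -iterS iterSr (bshift_delta_child wu).
rewrite iter_bshiftZ// (IH _ nw); apply/funext => x.
by rewrite path_weightS (parentE tree wu) mulrA.
Qed.

(** Each application of [B] moves the unit vector to a multiple of the one at the parent; one
    further application at the root annihilates it. *)
Lemma iter_bshift_delta0 r n u : (forall u, ~~ E u r) ->
  iter n (parent E) u = r -> iter n.+1 B (delta u) = fun=> 0.
Proof.
move=> rootr; elim: n u => [u /= ->|n IH u]; first exact: bshift_delta_root.
rewrite iterSr => /IH ur; rewrite iterSr.
have [vu|] := pselect (exists v, E v u).
  case: vu => v vu; rewrite (bshift_delta_child vu) iter_bshiftZ//.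
  rewrite -(parentE tree vu) ur; apply/funext => w; exact: mulr0.
(* Parent steps may idle at the root, so [u] itself can be parentless; then the first application
   already gives [0]. *)
move=> nE; rewrite bshift_delta_root ?iter_bshift0// => v.
by apply/negP => vu; apply: nE; exists v.
Qed.

End ShiftOnTree.

(** * An abstract space together with its dual norm *)

Section DualPairs.
Variables (R : realType) (s : scalars) (V : countType).
Local Notation K := (scalar_field R s).

(* [D A w] plays the role of the norm, in the dual of [X], of the functional
   with coefficients [w] on [A] and [0] elsewhere. *)
Record dual_pair (X : fun_space R s V) (D : set V -> (V -> R) -> \bar R) : Prop :=
  DualPair {
  dual_pair_fin : forall (t : seq V) (f : V -> K),
    (forall v, v \notin t -> f v = 0) -> fs_carrier X f;
  dual_pair_norm0 : fs_norm X (fun=> 0) <= 0;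
  dual_pair_comb : forall (a : K) (f g : V -> K),
    fs_carrier X f -> fs_carrier X g ->
    fs_carrier X (fun v => a * f v + g v) /\
    fs_norm X (fun v => a * f v + g v) <= modulus a * fs_norm X f + fs_norm X g;
  dual_pair_dense : forall (f : V -> K) (e : R), fs_carrier X f -> 0 < e ->
    exists2 t : seq V, uniq t &
      fs_norm X (f \- (fun v => if v \in t then f v else 0)) <= e;
  dual_pair_ge0 : forall (A : set V) (w : V -> R),
    A !=set0 -> (forall v, 0 <= w v) -> (0 <= D A w)%E;
  dual_pair_hoelder : forall (A : set V) (w : V -> R) (f : V -> K) (a : R),
    (forall v, 0 <= w v) -> fs_carrier X f -> 0 <= a -> (D A w <= a%:E)%E ->
    (\esum_(v in A) (w v * modulus (f v))%:E <= (a * fs_norm X f)%:E)%E;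
  dual_pair_attain : forall (A : set V) (w : V -> R) (c : R),
    (forall v, 0 <= w v) -> 0 <= c -> (c%:E < D A w)%E ->
    exists (t : seq V) (f : V -> R),
      [/\ uniq t, forall v, v \in t -> A v,
          forall v, 0 <= f v /\ (v \notin t -> f v = 0),
          c <= \sum_(v <- t) w v * f v
        & forall g : V -> K, (forall v, modulus (g v) = f v) ->
            fs_norm X g <= 1] }.

End DualPairs.

(** * Concatenation of chains *)

Section Chains.
Variables (R : realType) (T : Type) (X : set T) (d : T -> T -> R) (f : T -> T).
Variable e : R.
Local Notation chain := (delta_chain X d f e).

Lemma delta_chain_step x y : X x -> X y -> d (f x) y <= e -> chain x y.
Proof.
move=> Xx Xy xy; exists 1%N, (fun j => if j is 0 then x else y).
by split=> // -[|[]].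
Qed.

Lemma delta_chain_cons x y z : X x -> d (f x) y <= e -> chain y z -> chain x z.
Proof.
move=> Xx xy [k [c [k1 Xc c0 ck cd]]].
exists k.+1, (fun j => if j is i.+1 then c i else x); split=> //.
  by case=> // j; exact: Xc.
by case=> [|j]; [rewrite c0|exact: cd].
Qed.

Lemma delta_chain_trans x y z : chain x y -> chain y z -> chain x z.
Proof.
move=> [k [c [k1 Xc c0 <- cd]]] yz.
(* The entries of the first chain are prepended to the second one by one, starting with its last;
   [j] counts them from the end. *)
suff back j : (j <= k)%N -> j != 0 -> chain (c (k - j)%N) z.
  have <- : c (k - k)%N = x by rewrite subnn.
  by apply: back => //; rewrite -lt0n.
elim: j => // -[_ _ _|j IH jk _].
  apply: (delta_chain_cons (Xc _ (leq_subr _ _)) _ yz).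
  have kE : (k - 1).+1 = k by rewrite subn1 prednK.
  by have := cd (k - 1)%N; rewrite kE; apply.
apply: (delta_chain_cons (Xc _ (leq_subr _ _)) _ (IH (ltnW jk) isT)).
by rewrite -(subnSK jk); apply: cd; rewrite (subnSK jk) leq_subr.
Qed.

End Chains.

(** * The criterion for an abstract dual pair, starting with necessity *)

Section ChainRecurrenceCriterion.
Variables (R : realType) (s : scalars) (V : countType) (E : rel V).
Local Notation K := (scalar_field R s).
Variables (lam : V -> K).
Local Notation B := (bshift E lam).
Local Notation pw := (path_weight E lam).
Variables (X : fun_space R s V) (D : set V -> (V -> R) -> \bar R).
Local Notation dualnorm n v := (D (descendants E n v) (fun u => modulus (pw n u))).
Implicit Types (f g : V -> K) (u v w : V).
Hypothesis tree : directed_tree E.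
Hypothesis leafl : leafless E.
Hypothesis Xdual : dual_pair X D.
Hypothesis Xbounded : bshift_bounded E lam X.
Variable r : V.
Hypothesis rootr : forall u, ~~ E u r.

Let X0 : fs_carrier X (fun=> 0).
Proof. exact: (dual_pair_fin Xdual (t := [::])). Qed.

Let Xdelta u : fs_carrier X (delta R s u).
Proof.
by apply: (dual_pair_fin Xdual (t := [:: u])) => v; rewrite inE /delta => /negbTE->.
Qed.

Let XD f g : fs_carrier X f -> fs_carrier X g ->
  fs_carrier X (fun v => f v + g v) /\
  fs_norm X (fun v => f v + g v) <= fs_norm X f + fs_norm X g.
Proof.
move=> Xf Xg; have := dual_pair_comb Xdual 1 Xf Xg.
rewrite modulus1 mul1r (_ : (fun v => 1 * f v + g v) = fun v => f v + g v)//.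
by apply/funext => v; rewrite mul1r.
Qed.

Let XZ (a : K) f : fs_carrier X f ->
  fs_carrier X (fun v => a * f v) /\
  fs_norm X (fun v => a * f v) <= modulus a * fs_norm X f.
Proof.
move=> Xf; have [] := dual_pair_comb Xdual a Xf X0.
have -> : (fun v => a * f v + 0) = (fun v => a * f v).
  by apply/funext => v; rewrite addr0.
by move=> ? h; split=> //; rewrite (le_trans h)// gerDl; exact: dual_pair_norm0 Xdual.
Qed.

Let XB f g : fs_carrier X f -> fs_carrier X g -> fs_carrier X (f \- g).
Proof.
move=> Xf Xg; have [+ _] := dual_pair_comb Xdual (-1) Xg Xf.
rewrite (_ : (fun v => -1 * g v + f v) = f \- g)//.
by apply/funext => v; rewrite mulN1r addrC.
Qed.

Let distxx f : fs_dist X f f <= 0.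
Proof.
rewrite /fs_dist (_ : f \- f = fun=> 0); first exact: dual_pair_norm0 Xdual.
by apply/funext => v; rewrite /= subrr.
Qed.

Let dualnorm_ge0 n v : (0 <= dualnorm n v)%E.
Proof.
apply: (dual_pair_ge0 Xdual); first exact: descendants_neq0.
by move=> u; exact: modulus_ge0.
Qed.

Lemma modulus_iter_bshift_le n v f (a : R) : fs_carrier X f -> 0 <= a ->
  (dualnorm n v <= a%:E)%E -> modulus (iter n B f v) <= a * fs_norm X f.
Proof.
move=> Xf a0 na; rewrite -lee_fin (le_trans (iter_bshift_le tree Xbounded _ _ Xf))//.
by apply: (dual_pair_hoelder Xdual) => // u; exact: modulus_ge0.
Qed.

(* Along a chain, [B^m z_j] differs from [B^(m+j) z_0] by the images of the
   [j] errors, and the [i]-th of them is damped by the dual norm [a (m+i)]. *)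
Lemma chain_drift (a : nat -> R) v e k (z : nat -> V -> K) : 0 <= e ->
  (forall n, dualnorm n v <= (a n)%:E)%E -> (forall n, 0 <= a n) ->
  (forall j, (j <= k)%N -> fs_carrier X (z j)) ->
  (forall j, (j < k)%N -> fs_dist X (B (z j)) (z j.+1) <= e) ->
  forall j m, (j <= k)%N ->
    modulus (iter m B (z j) v) <=
    modulus (iter (m + j) B (z 0%N) v) + e * \sum_(i < j) a (m + i)%N.
Proof.
move=> e0 va a0 Xz zd; elim=> [|j IH] m jk.
  by rewrite big_ord0 mulr0 addr0 addn0.
have XBz : fs_carrier X (B (z j)).
  exact: (iter_bshift_closed Xbounded 1 (Xz _ (ltnW jk))).
have Xe := XB XBz (Xz _ jk).
(* The new entry is [B (z j)] minus the error of the step, written in the form to which linearity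
   applies. *)
have -> : z j.+1 = fun u => -1 * (B (z j) \- z j.+1) u + B (z j) u.
  by apply/funext => u /=; rewrite mulN1r opprB subrK.
rewrite (iter_bshift_comb Xbounded)// (le_trans (ler_modulusD _ _))//.
rewrite mulN1r modulusN -iterSr big_ord_recl addn0 mulrDr addrCA lerD//.
  rewrite (le_trans (modulus_iter_bshift_le Xe (a0 m) (va m)))// mulrC ler_wpM2r//.
  exact: zd.
rewrite (le_trans (IH m.+1 (ltnW jk)))// addSnnS lerD2l// ler_wpM2l//.
by under [X in _ <= X]eq_bigr do rewrite lift0 -addSnnS.
Qed.

(** Every term of the bound for iterates lives on a proper descendant of [v], where the unit vector
    at [v] vanishes. *)
Lemma iter_bshift_delta_self k v : iter k.+1 B (delta R s v) v = 0.
Proof.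
apply/eqP; rewrite -modulus_eq0 eq_le modulus_ge0 andbT -lee_fin.
rewrite (le_trans (iter_bshift_le tree Xbounded _ _ (Xdelta v)))//.
rewrite esum1// => u vu; rewrite /delta; case: eqVneq => [uv|_].
  by rewrite uv in vu; case: (descendants_irrefl tree rootr vu).
by rewrite modulus0 mulr0.
Qed.

Lemma chain_recurrent_dualnorm :
  chain_recurrent (fs_carrier X) (fs_dist X) B ->
  forall v, (\sum_(0 <= n <oo) dualnorm n v = +oo)%E.
Proof.
move=> cr v; apply: contrapT => /eqP; rewrite -ltey.
set S := limn _ => Soo.
have leS k : (\sum_(0 <= n < k) dualnorm n v <= S)%E.
  by apply: nneseries_lim_ge => n _.
have S0 : (0 <= S)%E by rewrite (le_trans _ (leS 0%N))// big_geq.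
have Sfin : S \is a fin_num by rewrite ge0_fin_numE.
pose a n := fine (dualnorm n v).
have va n : dualnorm n v = (a n)%:E.
  rewrite fineK// ge0_fin_numE// (le_lt_trans _ Soo)// (le_trans _ (leS n.+1))//.
  by rewrite big_nat_recr//= leeDr// sume_ge0.
have sumS k : \sum_(i < k) a i <= fine S.
  rewrite -lee_fin fineK// -sumEFin (le_trans _ (leS k))// big_mkord.
  by under eq_bigr do rewrite -va.
have a0 n : 0 <= a n by exact: fine_ge0.
(* Chosen so that [e * fine S < 1]; the added [1] keeps the denominator positive when the sum is
   zero. *)
pose e := (2 * (fine S + 1))^-1.
have S1 : 0 < fine S + 1 by rewrite ltr_wpDl// fine_ge0.
have e0 : 0 < e by rewrite invr_gt0 mulr_gt0.
have [k [z [k1 Xz z0 zk zd]]] := cr (delta R s v) (Xdelta v) e e0.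
have va' n : (dualnorm n v <= (a n)%:E)%E by rewrite va.
(* At the end of the chain the left side is the value [1] at [v], while the image of the starting
   vector contributes [0] there. *)
have := chain_drift (ltW e0) va' a0 Xz zd 0%N (leqnn k).
case: k k1 zk {Xz zd} => // k _ zk; rewrite add0n zk -[z 0%N]/(z 0) z0.
rewrite iter_bshift_delta_self modulus0 add0r /= /delta eqxx modulus1.
apply/negP; rewrite -ltNge (le_lt_trans (ler_wpM2l (ltW e0) (sumS k.+1)))//.
by rewrite /e mulrC ltr_pdivrMr ?mulr_gt0//; lra.
Qed.

(** * Sufficiency: chains of prescribed length starting at zero *)

Definition supp_in (t : seq V) f := forall v, v \notin t -> f v = 0.

(* [reach e n y]: [y] ends a chain of length [n] starting at [0]. Fixing the
   length makes these chains add up termwise. *)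
Fixpoint reach (e : R) (n : nat) (y : V -> K) : Prop :=
  if n is n'.+1 then
    [/\ fs_carrier X y & exists2 z, reach e n' z & fs_dist X (B z) y <= e]
  else y = fun=> 0.

Lemma reach_closed e n y : reach e n y -> fs_carrier X y.
Proof. by case: n => [->|n []]. Qed.

Lemma bshift0 : B (fun=> 0) = fun=> 0.
Proof. exact: (iter_bshift0 Xbounded X0 1). Qed.

Lemma bshiftD f g : fs_carrier X f -> fs_carrier X g ->
  B (fun v => f v + g v) = fun v => B f v + B g v.
Proof.
move=> Xf Xg; have := iter_bshift_comb Xbounded 1 1 Xf Xg => /=.
have mul1 (h h' : V -> K) : (fun v => 1 * h v + h' v) = fun v => h v + h' v.
  by apply/funext => v; rewrite mul1r.
by rewrite !mul1.
Qed.

Let distDD f g f' g' : fs_carrier X f -> fs_carrier X g ->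
  fs_carrier X f' -> fs_carrier X g' ->
  fs_dist X (fun v => f v + g v) (fun v => f' v + g' v) <=
  fs_dist X f f' + fs_dist X g g'.
Proof.
move=> Xf Xg Xf' Xg'; rewrite /fs_dist.
have [_] := XD (XB Xf Xf') (XB Xg Xg').
rewrite (_ : (fun v => _ + _) =
  (fun v => f v + g v) \- (fun v => f' v + g' v))//.
by apply/funext => v /=; rewrite opprD addrACA.
Qed.

Lemma reach_add e e' n y y' : reach e n y -> reach e' n y' ->
  reach (e + e') n (fun v => y v + y' v).
Proof.
elim: n y y' => [|n IH] y y' /=.
  by move=> -> ->; apply/funext => v; rewrite addr0.
move=> [Xy [z nz zy]] [Xy' [z' nz' zy']]; split; first by have [] := XD Xy Xy'.
exists (fun v => z v + z' v); first exact: IH.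
have Xz := reach_closed nz; have Xz' := reach_closed nz'.
rewrite bshiftD//.
have XBz := iter_bshift_closed Xbounded 1 Xz.
have XBz' := iter_bshift_closed Xbounded 1 Xz'.
by rewrite (le_trans (distDD _ _ _ _))// lerD.
Qed.

(** Since [B] fixes [0], a chain may wait at [0] without error before it starts. This brings chains
    of different lengths to a common length. *)
Lemma reach_pad e m n y : 0 <= e -> reach e n y -> reach e (m + n) y.
Proof.
move=> e0; elim: m n y => // m IH n y ny; rewrite addSnnS; apply: IH.
elim: n y ny => [y ->|n IH y] /=.
  split=> //; exists (fun=> 0) => //=.
  by rewrite bshift0 (le_trans (distxx _)).
move=> [Xy [z nz zy]]; split=> //; exists z => //; exact: IH.
Qed.

Lemma reach_chain e n y : 0 <= e -> reach e n y ->
  delta_chain (fs_carrier X) (fs_dist X) B e (fun=> 0) y.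
Proof.
move=> e0; elim: n y => [y ->|n IH y [Xy [z nz zy]]].
  by apply: delta_chain_step => //; rewrite bshift0 (le_trans (distxx _)).
apply: delta_chain_trans (IH _ nz) _; apply: delta_chain_step => //.
exact: reach_closed nz.
Qed.

(** The vectors [h k] are injected as errors in decreasing order of [k]; at the end [h k] has been
    shifted [k] more times. The bound is on [- h k] because the distance is the norm of the image
    minus the next entry. *)
Lemma reach_sum_iter e n (h : nat -> V -> K) :
  (forall k, fs_carrier X (h k)) -> (forall k, fs_norm X (fun v => - h k v) <= e) ->
  reach e n (fun v => \sum_(k < n) iter k B (h k) v).
Proof.
elim: n h => [|n IH] h Xh he.
  by apply/funext => v; rewrite big_ord0.
have Xs m (g : nat -> V -> K) : (forall k, fs_carrier X (g k)) ->
    fs_carrier X (fun v => \sum_(k < m) g k v).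
  move=> Xg; elim: m => [|m IHm].
    by rewrite (_ : (fun _ => _) = fun=> 0)//; apply/funext => v; rewrite big_ord0.
  rewrite (_ : (fun _ => _) = fun v => \sum_(k < m) g k v + g m v).
    by have [] := XD IHm (Xg m).
  by apply/funext => v; rewrite big_ord_recr.
have Xiter k : fs_carrier X (iter k B (h k)) by exact: iter_bshift_closed.
have Bs m (g : nat -> V -> K) : (forall k, fs_carrier X (g k)) ->
    B (fun v => \sum_(k < m) g k v) = fun v => \sum_(k < m) B (g k) v.
  move=> Xg; elim: m => [|m IHm].
    rewrite (_ : (fun _ => _) = fun=> 0); last first.
      by apply/funext => v; rewrite big_ord0.
    by rewrite bshift0; apply/funext => v; rewrite big_ord0.
  rewrite (_ : (fun _ => _) = fun v => \sum_(k < m) g k v + g m v); last first.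
    by apply/funext => v; rewrite big_ord_recr.
  by rewrite bshiftD ?IHm//; [apply/funext => v; rewrite big_ord_recr|exact: Xs].
split; first exact: (Xs n.+1 (fun k => iter k B (h k))).
(* The predecessor is the same sum for the shifted family; its image lacks only the term [h 0],
   which is the last error. *)
exists (fun v => \sum_(k < n) iter k B (h k.+1) v).
  by apply: (IH (fun k => h k.+1)) => k; [exact: Xh|exact: he].
rewrite (Bs n (fun k => iter k B (h k.+1))) => [|k]; last exact: iter_bshift_closed.
rewrite /fs_dist (_ : _ \- _ = fun v => - h 0%N v)//.
apply/funext => v /=; rewrite big_ord_recl.
under [X in _ - (_ + X)]eq_bigr do rewrite lift0.
by rewrite /= opprD addrCA subrr addr0.
Qed.


(** Prepares finitely many values strictly below the dual norms, as attainment demands. A single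
    infinite dual norm supplies [C] alone; otherwise a partial sum of at least [2 * C] is halved,
    which makes the inequality strict wherever the dual norm is positive. *)
Lemma dualnorm_sum_unbounded v (C : R) : 0 <= C ->
  (\sum_(0 <= n <oo) dualnorm n v = +oo)%E ->
  exists N (b : nat -> R), C <= \sum_(k < N) b k /\
    forall k, b k = 0 \/ (0 <= b k /\ ((b k)%:E < dualnorm k v)%E).
Proof.
move=> C0 voo; have [[n noo]|nfin] := pselect (exists n, dualnorm n v = +oo%E).
  exists n.+1, (fun k => if k == n then C else 0); split.
    rewrite big_ord_recr/= eqxx lerDr; apply: sumr_ge0 => k _.
    by case: ifPn.
  by move=> k; case: eqVneq => [->|_]; [right; rewrite noo ltey|left].
have dfin n : dualnorm n v = (fine (dualnorm n v))%:E.
  rewrite fineK// ge0_fin_numE// ltey; apply/eqP => noo.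
  by apply: nfin; exists n.
have [[N NC]|small] :=
    pselect (exists N, ((2 * C)%:E <= \sum_(0 <= n < N) dualnorm n v)%E).
  exists N, (fun k => fine (dualnorm k v) / 2); split.
    rewrite -mulr_suml ler_pdivlMr// mulrC -lee_fin (le_trans NC)//.
    rewrite big_mkord -sumEFin lee_sum// => k _; by rewrite -dfin.
  move=> k; have : 0 <= fine (dualnorm k v) by exact: fine_ge0.
  rewrite le_eqVlt => /predU1P[<-|k0]; first by left; rewrite mul0r.
  right; split; first by rewrite divr_ge0// ltW.
  by rewrite [ltRHS]dfin lte_fin ltr_pdivrMr// mulr_natr mulr2n ltrDl.
have : (\sum_(0 <= n <oo) dualnorm n v <= (2 * C)%:E)%E.
  apply: lime_le; first by apply: is_cvg_nneseries => n _ _; exact: dualnorm_ge0.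
  by near=> N; rewrite leNgt; apply/negP => /ltW NC; apply: small; exists N.
by rewrite voo leye_eq.
Unshelve. all: by end_near. Qed.

Lemma supp_in_split u t f : supp_in (u :: t) f ->
  exists f', [/\ supp_in t f', f' u = 0, forall w, w != u -> f' w = f w &
    f = fun w => f u * delta R s u w + f' w].
Proof.
move=> ft; exists (fun w => if w == u then 0 else f w); split.
- move=> w wt; case: eqVneq => // wu.
  by apply: ft; rewrite inE negb_or wu.
- by rewrite eqxx.
- by move=> w /negbTE ->.
- apply/funext => w; rewrite /delta.
  by case: eqVneq => [->|_]; rewrite ?mulr1 ?mulr0 ?addr0 ?add0r.
Qed.

(** After [n] steps all unit vectors over the [n]-th generation below [v] land on the one at [v], so
    only a scalar remains to be summed. *)
Lemma iter_bshift_supp n v t f : uniq t ->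
  (forall u, u \in t -> descendants E n v u) -> supp_in t f ->
  iter n B f = fun w => (\sum_(u <- t) pw n u * f u) * delta R s v w.
Proof.
elim: t f => [|u t IH] f.
  move=> _ _ f0; rewrite (_ : f = fun=> 0); last by apply/funext => w; exact: f0.
  by rewrite (iter_bshift0 Xbounded)//; apply/funext => w; rewrite big_nil mul0r.
move=> /andP[ut ut'] nt ft.
have [f' [f't fu f'E fE]] := supp_in_split ft.
rewrite [in LHS]fE.
have Xf' := dual_pair_fin Xdual f't.
rewrite (iter_bshift_comb Xbounded)//.
rewrite (iter_bshift_delta tree Xbounded X0 Xdelta (nt u (mem_head _ _))).
rewrite (IH f')//; last by move=> w wt; apply: nt; rewrite inE wt orbT.
apply/funext => w; rewrite big_cons mulrDl mulrA; congr (_ * _ + _ * _).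
  exact: mulrC.
rewrite !big_seq; apply: eq_bigr => x xt.
have xu : x != u by apply: contraNneq ut => <-.
by rewrite f'E.
Qed.

Hypothesis lam_neq0 : forall v, lam v != 0.

(** The nearly extremal nonnegative vector is multiplied by the phases of the path weights, so that
    all contributions arriving at [v] are nonnegative reals and add without cancellation. *)
Lemma dualnorm_attained k v (b : R) :
  b = 0 \/ (0 <= b /\ (b%:E < dualnorm k v)%E) ->
  exists h (beta : R), [/\ fs_carrier X h, fs_norm X h <= 1, b <= beta &
    iter k B h = fun w => embed s beta * delta R s v w].
Proof.
case=> [->|[b0 bk]].
  exists (fun=> 0), 0; split=> //.
    by rewrite (le_trans (dual_pair_norm0 Xdual)).
  by rewrite (iter_bshift0 Xbounded)//; apply/funext => w; rewrite embed0 mul0r.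
have [t [f [ut tk ft bt fnorm]]] :=
  dual_pair_attain Xdual (fun u => modulus_ge0 (pw k u)) b0 bk.
have pw0 u : pw k u != 0 by exact: path_weight_neq0.
pose h u := embed s (f u) * phase (pw k u).
have ht : supp_in t h.
  by move=> u tu; rewrite /h (ft u).2// embed0 mul0r.
exists h, (\sum_(u <- t) modulus (pw k u) * f u); split=> //.
- exact: (dual_pair_fin Xdual ht).
- apply: fnorm => u; rewrite /h modulusM modulus_phase// mulr1 modulus_embed//.
  exact: (ft u).1.
- rewrite (iter_bshift_supp ut tk ht); apply/funext => w; congr (_ * _).
  rewrite (big_morph (embed s) (@embedD R s) (@embed0 R s)); apply: eq_bigr => u _.
  by rewrite embedM -phaseK// /h mulrCA mulrC.
Qed.

Hypothesis dualnorm_diverges : forall v, (\sum_(0 <= n <oo) dualnorm n v = +oo)%E.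

Lemma reach_delta v (c : K) e : 0 < e ->
  exists N, reach e N (fun w => c * delta R s v w).
Proof.
(* A total of at least [C] makes the rescaling factor [c / S] of modulus at most [e]; the [1] keeps
   [C] positive when [c = 0]. *)
move=> e0; pose C := modulus c / e + 1.
have C0 : 0 < C by rewrite ltr_wpDl// divr_ge0 ?modulus_ge0 ?ltW.
have [N [b [Cb bk]]] := dualnorm_sum_unbounded (ltW C0) (dualnorm_diverges v).
have /choice[h /choice[beta hb]] := fun k => dualnorm_attained (bk k).
exists N; pose S := \sum_(k < N) beta k.
have CS : C <= S by rewrite (le_trans Cb)// ler_sum// => k _; have [] := hb k.
have S0 : 0 < S by exact: lt_le_trans CS.
have eS0 : embed s S != 0 by rewrite gt_eqF// -(embed0 R s) ltr_embed.
pose gam := c / embed s S.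
have game : modulus gam <= e.
  rewrite /gam modulusM modulusV modulus_embed ?(ltW S0)// ler_pdivrMr//.
  by rewrite mulrC -ler_pdivrMr// (le_trans _ CS)// /C lerDl.
have -> : (fun w => c * delta R s v w) =
    fun w => \sum_(k < N) iter k B (fun u => gam * h k u) w.
  apply/funext => w.
  under eq_bigr => k _.
    have [Xh _ _ hk] := hb k.
    rewrite (iter_bshiftZ Xbounded)// hk mulrA.
    over.
  rewrite -mulr_suml -mulr_sumr -(big_morph (embed s) (@embedD R s) (@embed0 R s)).
  by rewrite /gam divfK.
apply: (@reach_sum_iter e N (fun k u => gam * h k u)) => k; have [Xh h1 _ _] := hb k.
  by have [] := XZ gam Xh.
have [_ ] := XZ (- gam) Xh.
rewrite (_ : (fun v => - gam * _) = fun v => - (gam * h k v)); last first.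
  by apply/funext => w; rewrite mulNr.
by move=> /le_trans; apply; rewrite modulusN (le_trans _ game)// ler_piMr// modulus_ge0.
Qed.

(** One coordinate and the remaining vector are reached separately, each with half of the error; the
    two chains are padded to equal length and added. *)
Lemma reach_supp t f e : 0 < e -> supp_in t f -> exists N, reach e N f.
Proof.
elim: t f e => [|u t IH] f e e0 ft.
  by exists 0%N => /=; apply/funext => w; exact: ft.
have [f' [f't fu _ fE]] := supp_in_split ft.
rewrite fE.
have e2 : 0 < e / 2 by rewrite divr_gt0.
have [N1 r1] := reach_delta u (f u) e2.
have [N2 r2] := IH _ _ e2 f't.
exists (N2 + N1)%N; rewrite [e]splitr; apply: reach_add.
  by apply: reach_pad => //; exact: ltW.
by rewrite addnC; apply: reach_pad => //; exact: ltW.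
Qed.

Lemma supp_nilpotent t f : supp_in t f -> exists n, iter n B f = fun=> 0.
Proof.
elim: t f => [|u t IH] f ft.
  by exists 0%N => /=; apply/funext => w; exact: ft.
have [f' [f't fu _ fE]] := supp_in_split ft.
rewrite fE.
have [n nf'] := IH _ f't; have [m mr] := depth_exists tree rootr u.
(* The factor [m.+1] annihilates the unit vector at [u], of depth [m], and [n] the remaining
   part. *)
exists (n + m.+1)%N.
rewrite (iter_bshift_comb Xbounded)//; last exact: (dual_pair_fin Xdual f't).
rewrite iterD (iter_bshift_delta0 tree Xbounded X0 Xdelta rootr mr).
rewrite [in iter _ _ f']addnC iterD nf' !(iter_bshift0 Xbounded X0).
by apply/funext => w; rewrite mulr0 addr0.
Qed.

Lemma delta_chain_iter e n f : 0 <= e -> fs_carrier X f ->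
  delta_chain (fs_carrier X) (fs_dist X) B e f (iter n.+1 B f).
Proof.
move=> e0 Xf; have XB' k := iter_bshift_closed Xbounded k Xf.
elim: n => [|n IH].
  by apply: delta_chain_step => //; exact: le_trans (distxx _) _.
apply: delta_chain_trans IH _; apply: delta_chain_step (XB' _) (XB' n.+2) _.
exact: le_trans (distxx _) _.
Qed.

Lemma dualnorm_chain_recurrent : chain_recurrent (fs_carrier X) (fs_dist X) B.
Proof.
move=> x Xx e e0.
have trunc_supp t f : supp_in t (fun v => if v \in t then f v else 0).
  by move=> v /negbTE ->.
have XBx := iter_bshift_closed Xbounded 1 Xx.
(* The first step of the chain jumps from [x] to a finite truncation of [B x], whose exact orbit
   then runs into [0]. *)
have [t _ te] := dual_pair_dense Xdual XBx e0.
have Xy := dual_pair_fin Xdual (trunc_supp t (B x)).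
have [n n0] := supp_nilpotent (trunc_supp t (B x)).
apply: (@delta_chain_trans _ _ _ _ _ _ _ (fun=> 0)).
  apply: delta_chain_cons Xx te _.
  have := delta_chain_iter n (ltW e0) Xy.
  by rewrite iterS n0 bshift0.
have e2 : 0 < e / 2 by rewrite divr_gt0.
have [t' _ te'] := dual_pair_dense Xdual Xx e2.
set y := (fun v => if _ then x v else 0) in te'.
have [N Ny] := reach_supp e2 (trunc_supp t' x).
(* Padding by one step ensures that the chain to the truncation [y] has a last step; this step is
   redirected to [x], at the cost of the other half of [e]. *)
have [Xy' [z Nz zy]] := reach_pad 1 (ltW e2) Ny.
have Xz := reach_closed Nz.
have XBz := iter_bshift_closed Xbounded 1 Xz.
apply: (@reach_chain e N.+1) => //; first exact: ltW.
split=> //; exists z.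
  (* The earlier steps keep their errors of at most [e / 2], which is at most [e]. *)
  elim: (N) (z) Nz => // m IH w [Xw [w' mw' ww']]; split=> //; exists w'; first exact: IH.
  by rewrite (le_trans ww')// ler_pdivrMr// ler_peMr ?ler1n// ltW.
have [_] := dual_pair_comb Xdual (-1) (XB Xx Xy') (XB XBz Xy').
rewrite (_ : (fun v => _ + _) = B z \- x); last first.
  apply/funext => v /=; rewrite mulN1r opprB addrC; exact: subrKA.
move=> /le_trans; apply; rewrite modulusN modulus1 mul1r [leRHS]splitr.
exact: lerD.
Qed.

End ChainRecurrenceCriterion.

(** * Norm and density in the spaces of [p]-summable families *)

Section LebesgueSpaces.
Variables (R : realType) (s : scalars) (V : countType) (p : R).
Hypothesis p1 : 1 <= p.
Local Notation K := (scalar_field R s).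
Local Notation X := (lp s V p).
Implicit Types (f g : V -> K) (t : seq V).

Let p0 : 0 < p. Proof. exact: lt_le_trans p1. Qed.

Lemma lp_norm_ge0 f : 0 <= fs_norm X f.
Proof. exact: powR_ge0. Qed.

Lemma lp_normE f : fs_carrier X f ->
  (\esum_(v in [set: V]) (modulus (f v) `^ p)%:E = (fs_norm X f `^ p)%:E)%E.
Proof.
move=> /= Xf; have [|c c0 fc] := esum_fin _ Xf; first by move=> v _; exact: powR_ge0.
by rewrite fc/= powRVK// gt_eqF.
Qed.

Lemma lp_sum_le f (t : seq V) : fs_carrier X f -> uniq t ->
  \sum_(v <- t) modulus (f v) `^ p <= fs_norm X f `^ p.
Proof.
move=> Xf ut; have /esum_leP/(_ t ut) h :
    (\esum_(v in [set: V]) (modulus (f v) `^ p)%:E <= (fs_norm X f `^ p)%:E)%E.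
  by rewrite lp_normE.
exact: h.
Qed.

Lemma lp_bound f a : 0 <= a ->
  (forall t, uniq t -> \sum_(v <- t) modulus (f v) `^ p <= a `^ p) ->
  fs_carrier X f /\ fs_norm X f <= a.
Proof.
move=> a0 fa.
have fa' : (\esum_(v in [set: V]) (modulus (f v) `^ p)%:E <= (a `^ p)%:E)%E.
  by apply/esum_leP => t ut _; exact: fa.
have Xf : fs_carrier X f by rewrite /= (le_lt_trans fa')// ltry.
by split=> //; rewrite -(ler_powR_pos p0) ?lp_norm_ge0// -lee_fin -lp_normE.
Qed.

Lemma lp_fin (t : seq V) f : (forall v, v \notin t -> f v = 0) -> fs_carrier X f.
Proof.
move=> ft; have S0 : 0 <= \sum_(v <- undup t) modulus (f v) `^ p.
  by apply: sumr_ge0 => v _; exact: powR_ge0.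
apply: (@lp_bound f ((\sum_(v <- undup t) modulus (f v) `^ p) `^ p^-1) _ _).1.
  exact: powR_ge0.
move=> t' ut'; rewrite powRVK ?gt_eqF//; apply: sum_le_support => //.
- exact: undup_uniq.
- by move=> u; exact: powR_ge0.
- by move=> u; rewrite mem_undup => /ft ->; rewrite modulus0 powR0 ?gt_eqF.
Qed.

Lemma lp_norm0 : fs_norm X (fun=> 0) <= 0.
Proof.
apply: (@lp_bound (fun=> 0) 0 _ _).2 => // t ut.
by rewrite modulus0 powR0 ?gt_eqF// big1.
Qed.

Lemma lp_comb (a : K) f g : fs_carrier X f -> fs_carrier X g ->
  fs_carrier X (fun v => a * f v + g v) /\
  fs_norm X (fun v => a * f v + g v) <= modulus a * fs_norm X f + fs_norm X g.
Proof.
move=> Xf Xg; apply: lp_bound.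
  by rewrite addr_ge0 ?lp_norm_ge0// mulr_ge0 ?lp_norm_ge0 ?modulus_ge0.
move=> t ut.
apply: (@le_trans _ _ (\sum_(v <- t) (modulus a * modulus (f v) + modulus (g v)) `^ p)).
  apply: ler_sum => v _.
  rewrite ler_powR_pos ?addr_ge0 ?mulr_ge0 ?modulus_ge0//.
  by rewrite -modulusM ler_modulusD.
apply: minkowski_sum => //.
- by move=> v; rewrite mulr_ge0 ?modulus_ge0.
- by move=> v; rewrite modulus_ge0.
- by rewrite mulr_ge0 ?modulus_ge0 ?lp_norm_ge0.
- exact: lp_norm_ge0.
- rewrite powRM ?modulus_ge0 ?lp_norm_ge0//.
  under eq_bigr do rewrite powRM ?modulus_ge0//.
  by rewrite -mulr_sumr ler_wpM2l ?powR_ge0// lp_sum_le.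
- exact: lp_sum_le.
Qed.

Lemma lp_dense f (e : R) : fs_carrier X f -> 0 < e ->
  exists2 t : seq V, uniq t &
    fs_norm X (f \- (fun v => if v \in t then f v else 0)) <= e.
Proof.
move=> Xf e0; pose N := fs_norm X f `^ p.
have [|t [ut _ Nt]] := @esum_gt_seq R V [set: V] (fun v => modulus (f v) `^ p) (N - e `^ p).
  by rewrite lp_normE// lte_fin ltrBlDr ltrDl powR_gt0.
exists t => //; apply: (@lp_bound _ e _ _).2; first exact: ltW.
move=> t' ut'.
have -> : \sum_(v <- t') modulus ((f \- (fun v => if v \in t then f v else 0)) v) `^ p
    = \sum_(v <- [seq v <- t' | v \notin t]) modulus (f v) `^ p.
  rewrite big_filter [RHS]big_mkcond/=; apply: eq_bigr => v _.
  by case: ifPn => vt; rewrite ?subr0// subrr modulus0 powR0 ?gt_eqF.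
have := @lp_sum_le f (t ++ [seq v <- t' | v \notin t]) Xf.
rewrite cat_uniq ut filter_uniq// andbT => /(_ _); rewrite big_cat/= -/N.
have -> : ~~ has (mem t) [seq v <- t' | v \notin t].
  by apply/hasPn => v; rewrite mem_filter => /andP[].
by move=> /(_ isT); lra.
Qed.

End LebesgueSpaces.

(** * Dual norms of the spaces of [p]-summable families *)

Section DualOfLebesgueSpaces.
Variables (R : realType) (s : scalars) (V : countType).
Local Notation K := (scalar_field R s).

(** The dual norm is the supremum norm, approached on a unit vector at an index where the weight is
    nearly maximal. *)
Lemma dual_pair_l1 :
  dual_pair (lp s V (1 : R)) (fun A w => ereal_sup [set (w u)%:E | u in A]).
Proof.
have p1 : (1 : R) <= 1 by [].
split.
- exact: lp_fin.
- exact: lp_norm0.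
- exact: lp_comb.
- exact: lp_dense.
- move=> A w [u Au] w0; rewrite (le_trans (_ : 0 <= (w u)%:E)%E) ?lee_fin//.
  by apply: ereal_sup_ubound; exists u.
- move=> A w f a w0 Xf a0 wa; apply/esum_leP => t ut tA.
  have := lp_sum_le p1 Xf ut; rewrite powRr1 ?lp_norm_ge0// => /(ler_wpM2l a0).
  apply: le_trans; rewrite mulr_sumr big_seq [leRHS]big_seq ler_sum// => u ut'.
  rewrite powRr1 ?modulus_ge0// ler_wpM2r ?modulus_ge0// -lee_fin (le_trans _ wa)//.
  by apply: ereal_sup_ubound; exists u => //; exact: tA.
- move=> A w c w0 c0 /ereal_sup_gt[_ [u Au <-]]; rewrite lte_fin => cu.
  exists [:: u], (fun v => (v == u)%:R); split=> //.
  + by move=> v; rewrite inE => /eqP ->.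
  + by move=> v; rewrite ler0n inE; split=> // /negbTE ->.
  + by rewrite big_seq1 eqxx mulr1 ltW.
  + move=> g gu; apply: (@lp_bound _ _ _ _ p1 g 1 _ _).2 => // t ut.
    rewrite powR1; under eq_bigr do rewrite powRr1 ?modulus_ge0// gu.
    rewrite (le_trans (sum_le_support (t := [:: u]) ut _ _ _))//.
    * by move=> v; rewrite inE => /negbTE ->.
    * by rewrite big_seq1 eqxx.
Qed.

Lemma dual_pair_lp (p q : R) : 1 < p -> p^-1 + q^-1 = 1 ->
  dual_pair (lp s V p)
    (fun A w => (\esum_(u in A) (w u `^ q)%:E) `^ q^-1)%E.
Proof.
move=> p1 pq; have p1' := ltW p1.
have p0 : 0 < p by rewrite (lt_trans _ p1).
have q0 : 0 < q.
  by rewrite -invr_gt0 -(addKr p^-1 q^-1) pq addrC subr_gt0 invf_lt1.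
have q0' := lt0r_neq0 q0.
(* Removing the outer root turns bounds on the dual norm into bounds on finite sums, also when the
   unordered sum is infinite. *)
have dual_le A (w : V -> R) (a : R) : 0 <= a ->
    ((\esum_(u in A) (w u `^ q)%:E) `^ q^-1 <= a%:E)%E <->
    (\esum_(u in A) (w u `^ q)%:E <= (a `^ q)%:E)%E.
  move=> a0; have [oo|fin] := eqVneq (\esum_(u in A) (w u `^ q)%:E)%E +oo%E.
    by rewrite oo poweRyr ?invr_eq0// !leye_eq.
  have [|c c0 ->] := @esum_fin R V A (fun u => w u `^ q) (fun u _ => powR_ge0 _ _).
    by rewrite ltey.
  rewrite poweR_EFin !lee_fin; split=> [ca|ca].
    by rewrite -(powRVK c0 q0') ler_powR_pos ?powR_ge0.
  by rewrite -(powRK a0 q0') ler_powR_pos ?powR_ge0 ?invr_gt0.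
split.
- exact: lp_fin.
- exact: lp_norm0.
- exact: lp_comb.
- exact: lp_dense.
- by move=> A w A0 w0; exact: poweR_ge0.
- move=> A w f a w0 Xf a0 /(dual_le _ _ _ a0)/esum_leP wa; apply/esum_leP => t ut tA.
  apply: (@hoelder_sum _ _ _ _ _ q p) => //.
  + by move=> u; exact: modulus_ge0.
  + exact: lp_norm_ge0.
  + by rewrite addrC.
  + exact: wa.
  + exact: lp_sum_le.
- move=> A w c w0 c0 cw.
  have {}cw : ((c `^ q)%:E < \esum_(u in A) (w u `^ q)%:E)%E.
    by rewrite ltNge; apply/negP => /(dual_le _ _ _ c0); rewrite leNgt cw.
  have [t [ut tA ct]] := esum_gt_seq cw.
  set S := \sum_(u <- t) _ in ct.
  have S0 : 0 < S by rewrite (le_lt_trans _ ct)// powR_ge0.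
  (* The equality case of Hoelder's inequality: since [p * (q - 1) = q], the [p]-th powers sum to
     [S / S = 1], and the pairing with [w] is [S / S]^ p^-1 = S [^ q^-1], which exceeds [c]. *)
  pose f u := if u \in t then w u `^ (q - 1) / S `^ p^-1 else 0.
  have f0 u : 0 <= f u by rewrite /f; case: ifP => // _; rewrite divr_ge0 ?powR_ge0.
  have ft u : u \notin t -> f u = 0 by rewrite /f => /negbTE ->.
  exists t, f; split=> //; first by move=> u; split; [exact: f0|exact: ft].
    rewrite (_ : \sum_(v <- t) _ = S / S `^ p^-1).
      have -> : S / S `^ p^-1 = S `^ q^-1.
        have -> : q^-1 = 1 - p^-1 by rewrite -pq addrAC subrr add0r.
        by rewrite powRB ?(lt0r_neq0 S0) ?implybT// powRr1// ltW.
      by rewrite -(powRK c0 q0') ler_powR_pos ?powR_ge0 ?invr_gt0 ?(ltW S0) ?(ltW ct).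
    rewrite mulr_suml !big_seq; apply: eq_bigr => u ut'.
    by rewrite /f ut' mulrA mulr_powRB1.
  move=> g gf; apply: (@lp_bound _ _ _ _ p1' g 1 _ _).2 => // t' ut'.
  rewrite powR1; under eq_bigr do rewrite gf.
  apply: (@le_trans _ _ (\sum_(u <- t) f u `^ p)).
    apply: sum_le_support => // u; first exact: powR_ge0.
    by move=> /ft ->; rewrite powR0 ?gt_eqF.
  rewrite (_ : \sum_(u <- t) _ = S / S); first by rewrite divff// gt_eqF.
  rewrite mulr_suml !big_seq; apply: eq_bigr => u ut2.
  rewrite /f ut2 powR_divl ?powR_ge0 ?powR_gt0// -!powRrM mulVf ?gt_eqF//.
  rewrite powRr1 ?(ltW S0)// mulrC; congr (w u `^ _ / _).
  have pqE : p * q = p + q.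
    by rewrite -[LHS]mulr1 -pq; field; rewrite q0' lt0r_neq0.
  by rewrite mulrBl mul1r mulrC pqE addrAC subrr add0r.
Qed.

End DualOfLebesgueSpaces.

(** * The space of families vanishing at infinity and its dual norm *)

Section SupremumSpace.
Variables (R : realType) (s : scalars) (V : countType).
Local Notation K := (scalar_field R s).
Local Notation X := (c0 R s V).
Implicit Types (f g : V -> K).

Lemma c0_norm_le f (M : R) : 0 <= M -> (forall v, modulus (f v) <= M) ->
  fs_norm X f <= M.
Proof.
move=> M0 fM /=; have [->|ne] := eqVneq (range (fun v => modulus (f v))) set0.
  (* For empty [V] the supremum takes its default value [0]. *)
  by rewrite sup0.
by apply: ge_sup; [exact/set0P|move=> _ [v _ <-]].
Qed.

Lemma c0_le_norm f v : fs_carrier X f -> modulus (f v) <= fs_norm X f.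
Proof.
move=> /(_ 1 ltr01)[F finF F1] /=; apply: ub_le_sup; last by exists v.
(* An upper bound making the supremum genuine: values outside [F] are below [1], and those in [F]
   are terms of the sum. *)
exists (1 + \sum_(u <- fset_set F) modulus (f u)) => _ [u _ <-].
have sum0 (r : seq V) : 0 <= \sum_(w <- r) modulus (f w).
  by apply: sumr_ge0 => w _; exact: modulus_ge0.
have [Fu|/F1/ltW fu] := pselect (F u); last by rewrite (le_trans fu)// lerDl.
rewrite (big_rem u) ?in_fset_set ?inE//= addrCA lerDl addr_ge0//.
Qed.

Lemma c0_norm_ge0 f : fs_carrier X f -> 0 <= fs_norm X f.
Proof.
move=> Xf; have [[v]|nV] := pselect (inhabited V).
  by rewrite (le_trans _ (c0_le_norm v Xf))// modulus_ge0.
have r0 : range (fun v => modulus (f v)) = set0.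
  by rewrite -subset0 => x [v _ _]; exact: (nV (inhabits v)).
by rewrite /= r0 sup0.
Qed.

(** The dual norm is the sum of the weights, approached on indicators of finite sets. *)
Lemma dual_pair_c0 :
  dual_pair X (fun A w => \esum_(u in A) (w u)%:E)%E.
Proof.
split.
- move=> t f ft e e0; exists [set` t] => [|v vt]; first exact: finite_seq.
  by rewrite ft ?modulus0//; apply/negP.
- by apply: c0_norm_le => // v; rewrite modulus0.
- move=> a f g Xf Xg; split; last first.
    apply: c0_norm_le.
      by rewrite addr_ge0 ?c0_norm_ge0// mulr_ge0 ?modulus_ge0 ?c0_norm_ge0.
    move=> v; rewrite (le_trans (ler_modulusD _ _))// modulusM.
    by rewrite lerD ?ler_wpM2l ?modulus_ge0 ?c0_le_norm.
  move=> e e0; have a0 : 0 < modulus a + 1 by rewrite ltr_wpDl ?modulus_ge0.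
  have e2 : 0 < e / 2 by rewrite divr_gt0.
  have [F finF Fe] := Xf _ (divr_gt0 e2 a0); have [G finG Ge] := Xg _ e2.
  exists (F `|` G); first by rewrite finite_setU.
  move=> v /not_orP[/Fe fe /Ge ge]; rewrite (le_lt_trans (ler_modulusD _ _))//.
  rewrite [ltRHS]splitr ler_ltD// modulusM.
  rewrite (le_trans (ler_wpM2l (modulus_ge0 a) (ltW fe)))//.
  by rewrite mulrCA ler_piMr ?(ltW e2)// ler_pdivrMr// mul1r lerDl.
- move=> f e Xf e0; have [F finF Fe] := Xf e e0.
  exists (fset_set F); first exact: fset_uniq.
  apply: c0_norm_le => [|v /=]; first exact: ltW.
  case: ifPn => vF; first by rewrite subrr modulus0 ltW.
  rewrite subr0 ltW//; apply: Fe => Fv.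
  by move: vF; rewrite in_fset_set// mem_set.
- by move=> A w _ w0; apply: esum_ge0 => u _; rewrite lee_fin.
- move=> A w f a w0 Xf a0 /esum_leP wa; apply/esum_leP => t ut tA.
  apply: (@le_trans _ _ (\sum_(u <- t) w u * fs_norm X f)).
    by apply: ler_sum => u _; rewrite ler_wpM2l ?c0_le_norm.
  by rewrite -mulr_suml ler_wpM2r ?c0_norm_ge0 ?wa.
- move=> A w c w0 c0 /esum_gt_seq[t [ut tA ct]].
  exists t, (fun v => (v \in t)%:R); split=> //.
  + by move=> v; rewrite ler0n; split=> // /negbTE ->.
  + rewrite (le_trans (ltW ct))// big_seq [leRHS]big_seq.
    by apply: ler_sum => u ->; rewrite mulr1.
  + by move=> g gt; apply: c0_norm_le => // v; rewrite gt lern1 leq_b1.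
Qed.

End SupremumSpace.

(** * Chain recurrence on the three concrete spaces *)

Theorem theorem3p2 (R : realType) (s : scalars) (V : countType) (E : rel V)
    (tree : directed_tree E) (has_root : rooted E) (no_leaf : leafless E)
    (lam : V -> scalar_field R s) (lam_neq0 : forall v, lam v != 0) :
  [/\ (* (a) *)
      let X := lp s V (1 : R) in
      bshift_bounded E lam X ->
      (chain_recurrent (fs_carrier X) (fs_dist X) (bshift E lam) <->
       forall v : V,
         (\sum_(0 <= n <oo)
            ereal_sup [set (modulus (path_weight E lam n u))%:E
                      | u in descendants E n v] = +oo)%E),
      (* (b) *)
      forall p q : R, 1 < p -> p^-1 + q^-1 = 1 ->
      let X := lp s V p in
      bshift_bounded E lam X ->
      (chain_recurrent (fs_carrier X) (fs_dist X) (bshift E lam) <->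
       forall v : V,
         (\sum_(0 <= n <oo)
            (\esum_(u in descendants E n v)
               (modulus (path_weight E lam n u) `^ q)%:E) `^ q^-1 = +oo)%E)
    & (* (c) *)
      let X := c0 R s V in
      bshift_bounded E lam X ->
      (chain_recurrent (fs_carrier X) (fs_dist X) (bshift E lam) <->
       forall v : V,
         (\sum_(0 <= n <oo)
            \esum_(u in descendants E n v)
               (modulus (path_weight E lam n u))%:E = +oo)%E)].
Proof.
have [r rootr] := has_root.
have criterion X D : dual_pair X D -> bshift_bounded E lam X ->
    chain_recurrent (fs_carrier X) (fs_dist X) (bshift E lam) <->
    forall v, (\sum_(0 <= n <oo) D (descendants E n v)
                 (fun u => modulus (path_weight E lam n u)) = +oo)%E.
  move=> XD Xb; split.
    exact: (chain_recurrent_dualnorm tree no_leaf XD Xb rootr).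
  exact: (dualnorm_chain_recurrent tree no_leaf XD Xb rootr lam_neq0).
split.
- exact: (criterion _ _ (dual_pair_l1 R s V)).
- by move=> p q p1 pq; exact: (criterion _ _ (dual_pair_lp s V p1 pq)).
- exact: (criterion _ _ (dual_pair_c0 R s V)).
Qed.
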